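(* There are absolute constants $c_1,c_2\in(0,1)$ such that for all positive integers $m$ and $r$ there are probability distributions $\Lambda_0,\Lambda_1$ on $\mathbb{N}^m$ with \[ \Lambda_i\in\operatorname{conv}\left(\mathfrak{B}^*\!\left(r,c_1,\tfrac{c_2}{\sqrt r},1\right)^{\otimes m}\right),\qquad \operatorname{supp}\Lambda_i\subseteq(\mathrm{MP}^*_{m,r})^{-1}(i)\qquad(i=0,1), \] and $\operatorname{orth}(\Lambda_1-\Lambda_0)\ge\min\{m,c_1\sqrt r\}$.
   Context: $\mathbb{N}=\{0,1,2,\dots\}$. $\mathfrak{B}^*(r,c,\alpha)$ is the family of probability distributions $\lambda$ on $\mathbb{N}$ with $\operatorname{supp}\lambda=\{0,1,\dots,r'\}$ for some integer $0\le r'\le r$ and $\frac{c}{(t+1)^2 2^{\alpha t}}\le\lambda(t)\le\frac{1}{c(t+1)^2 2^{\alpha t}}$ for $t\in\operatorname{supp}\lambda$. $\mathfrak{B}^*(r,c,\alpha,\Delta)$ is the family of probability distributions $\lambda$ on $\mathbb{N}$ of the form $\lambda(t)=\lambda'(t-a)$ for some $\lambda'\in\mathfrak{B}^*(r,c,\alpha)$ and $a\in[0,\Delta]$. For a family $\mathcal F$ of distributions on $\mathbb{N}$, $\mathcal F^{\otimes m}$ is the set of product distributions $\lambda_1\otimes\cdots\otimes\lambda_m$ with $\lambda_i\in\mathcal F$, and $\operatorname{conv}$ denotes the convex hull. $\mathrm{MP}^*_{m,r}\colon\{0,1,\dots,r\}^m\to\{0,1\}$ is $\mathrm{MP}^*_{m,r}(t_1,\dots,t_m)=1$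 iff $t_i\ge1$ for all $i$. $\operatorname{orth}\phi$ is the minimum total degree of a real polynomial $p$ with $\sum_x\phi(x)p(x)\neq0$ ($\infty$ if none). *)

(* Defs.v *)
From mathcomp Require Import all_boot all_order all_algebra.
From mathcomp Require Import all_classical reals ereal sequences esum exp.
(* [mpoly] is not imported: its notations clash with those of the analysis
   files. *)
From mathcomp Require mpoly.

Set Implicit Arguments.
Unset Strict Implicit.
Unset Printing Implicit Defensive.

Import Order.TTheory GRing.Theory Num.Theory.

Local Open Scope classical_set_scope.
Local Open Scope ring_scope.

(* Distributions on the countable spaces N and N^m are given by their mass
   functions. N^m is {ffun 'I_m -> nat}. *)
Definition is_distr (R : realType) (T : choiceType) (f : T -> R) : Prop :=
  (forall x, 0 <= f x) /\ \esum_(x in [set: T]) (f x)%:E = 1%:E.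

Definition supp (R : realType) (T : Type) (f : T -> R) : set T :=
  [set x | f x != 0].

Definition Bstar (R : realType) (r : nat) (c alpha : R) : set (nat -> R) :=
  [set lam | [/\ is_distr lam,
    (exists2 r' : nat, (r' <= r)%N & supp lam = [set t | (t <= r')%N]) &
    forall t : nat, supp lam t ->
      c / ((t%:R + 1) ^+ 2 * 2 `^ (alpha * t%:R)) <= lam t
        <= 1 / (c * (t%:R + 1) ^+ 2 * 2 `^ (alpha * t%:R))]].

(* lam' is understood to vanish at negative integers, and the shift a is an
   integer since lam and lam' both live on N. *)
Definition Bstar_shift (R : realType) (r : nat) (c alpha : R) (Delta : nat) :
    set (nat -> R) :=
  [set lam | is_distr lam /\
    exists lam' : nat -> R, exists a : nat,
      [/\ Bstar r c alpha lam', (a <= Delta)%N &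
          forall t : nat,
            lam t = if (a <= t)%N then lam' (t - a)%N else 0]].

Definition tensor_power (R : realType) (F : set (nat -> R)) (m : nat) :
    set ({ffun 'I_m -> nat} -> R) :=
  [set L | exists2 lam : 'I_m -> nat -> R,
    (forall i, F (lam i)) &
    forall x : {ffun 'I_m -> nat}, L x = \prod_(i < m) lam i (x i)].
Arguments tensor_power {R} F m _.

Definition conv (R : realType) (T : Type) (S : set (T -> R)) : set (T -> R) :=
  [set L | exists n : nat, exists w : 'I_n -> R, exists g : 'I_n -> T -> R,
    [/\ forall k, 0 <= w k, \sum_(k < n) w k = 1, forall k, S (g k) &
        forall x, L x = \sum_(k < n) w k * g k x]].

Definition MPstar (m r : nat) (t : {ffun 'I_m -> 'I_r.+1}) : bool :=
  [forall i, (1 <= t i)%N].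

(* The inclusion of {0,...,r}^m in N^m. *)
Definition grid_incl (m r : nat) (t : {ffun 'I_m -> 'I_r.+1}) :
    {ffun 'I_m -> nat} :=
  [ffun i => t i : nat].

Definition total_degree (R : realType) (m : nat) (p : mpoly.mpoly m R) : nat :=
  \max_(mon <- mpoly.msupp p) mpoly.mdeg mon.

(* The sum over N^m is a finitely supported sum; it has its usual meaning for
   phi of finite support, which is the only case in which orth is used. *)
Definition poly_pairing (R : realType) (m : nat)
    (phi : {ffun 'I_m -> nat} -> R) (p : mpoly.mpoly m R) : R :=
  \sum_(x \in [set: {ffun 'I_m -> nat}])
    phi x * mpoly.meval (fun i => (x i)%:R) p.

(* An infimum of natural numbers is a minimum when the set is nonempty, and
   [ereal_inf set0 = +oo]. The pairing with p = 0 is 0, so the value of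
   [total_degree 0] is irrelevant. *)
Definition orth (R : realType) (m : nat) (phi : {ffun 'I_m -> nat} -> R) :
    \bar R :=
  ereal_inf [set ((total_degree p)%:R)%:E |
    p in [set p : mpoly.mpoly m R | poly_pairing phi p != 0]].

(* Main.v *)
Require Import Defs.
From mathcomp Require Import all_boot all_order all_algebra.
From mathcomp Require Import all_classical reals ereal sequences esum exp.
From mathcomp Require Import ring lra zify.
From mathcomp Require mpoly.

(* Let l0 be the point mass at 0, and let l1, l2 be laws on {1, ..., r} such
   that l1 and (l0 + l2) / 2 have the same moments of order < c sqrt(r). Put
   Lambda_1 = l1^{(x) m} and let Lambda_0 be the average of the products having
   the factor l0 on an odd set A of coordinates and l2 on its complement. Since
     Lambda_0 = ((l0 + l2) / 2)^{(x) m} - ((l2 - l0) / 2)^{(x) m},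
   a monomial of degree < min(m, c sqrt(r)) cannot distinguish Lambda_1 from
   Lambda_0: some coordinate is missing from it, and there l2 - l0 integrates
   to 0.

   The laws come from a signed function w on {0, ..., r} orthogonal to low
   degrees, with w(0) = 1/2, sum_(t >= 1) |w(t)| <= 5/4 and
   |w(t)| <= 18 h(t), where h is the required profile 1 / (t^2 2^(alpha (t-1))):
   take l1 = (|w| - w) / 2 + K h and l2 = |w| + w + 2 K h on t >= 1, where the
   constant K making l1 a probability is bounded below because of the bound on
   sum_(t >= 1) |w(t)|. The function w is carried by 0, 1, 3 and the points 100 i^2
   with i <= n ~ sqrt(r) / 10. *)

Set Implicit Arguments.
Unset Strict Implicit.
Unset Printing Implicit Defensive.

Import Order.TTheory GRing.Theory Num.Theory.

Local Open Scope classical_set_scope.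
Local Open Scope ring_scope.

(** * Alternating binomial sums and the Gaussian decay of their centred weights *)

(** Up to sign this is the [N]-th finite difference of [q] at 0. Writing a polynomial as
    [q * 'X + c], the constant contributes [c (1 - 1)^(N+1) = 0], and the absorption identity
    [j C(N+1, j) = (N+1) C(N, j-1)] turns the rest into [-(N+1)] times the sum of order [N] for
    [q(X + 1)], whose degree is one less. *)
Lemma alternating_binomial_sum_eq0 (R : idomainType) (N : nat) (q : {poly R}) :
  (size q <= N)%N ->
  \sum_(j < N.+1) (-1) ^+ j * 'C(N, j)%:R * q.[j%:R] = 0.
Proof.
elim: N q => [|N IHN] q sq.
  move: sq; rewrite leqn0 size_poly_eq0 => /eqP ->.
  by rewrite big1 // => j _; rewrite horner0 mulr0.
elim/poly_ind: q sq => [|q c _] sq.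
  by rewrite big1 // => j _; rewrite horner0 mulr0.
have sq' : (size (q \Po ('X + 1%:P)) <= N)%N.
  rewrite size_comp_poly2 ?size_XaddC //.
  by move: sq; rewrite size_MXaddC; case: ifP => // /andP[/eqP -> _]; rewrite size_poly0.
under eq_bigr do rewrite hornerMXaddC mulrDr.
rewrite big_split /=.
have -> : \sum_(j < N.+2) (-1) ^+ j * 'C(N.+1, j)%:R * c = 0.
  rewrite -mulr_suml.
  have := exprDn (1 : R) (-1) N.+1; rewrite subrr expr0n /= => /esym E.
  rewrite -[RHS](mul0r c); congr (_ * _); rewrite -[RHS]E; apply: eq_bigr => j _.
  by rewrite expr1n mul1r mulr_natr.
rewrite addr0 big_ord_recl /= mulr0 mulr0 add0r.
have := IHN _ sq' => /(congr1 (fun x => - N.+1%:R * x)); rewrite mulr0 => Z; rewrite -[RHS]Z {Z}.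
rewrite mulr_sumr; apply: eq_bigr => j _.
rewrite horner_comp !hornerE /bump /= add1n exprS.
have /(congr1 (fun x => x%:R : R)) := mul_bin_diag N.+1 j.
rewrite /= !natrM => E.
transitivity (- (-1) ^+ j * q.[j%:R + 1] * (N.+1%:R * 'C(N, j)%:R)); last by ring.
by rewrite E -natr1; ring.
Qed.

Lemma sum_ord_centered (V : nmodType) (n : nat) (F : nat -> V) :
  \sum_(j < (n + n).+1) F j =
  F n + \sum_(i < n) (F (n - i.+1)%N + F (n + i.+1)%N).
Proof.
rewrite -(big_mkord xpredT F) -addnS (big_cat_nat _ (n := n)) //=; last lia.
rewrite big_split /= addrCA; congr (_ + _).
  by rewrite big_nat_rev big_mkord; apply: eq_bigr => i _; congr F; lia.
rewrite -{1}[n]add0n big_addn addKn.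
rewrite big_nat_recl // big_mkord add0n; congr (_ + _).
by apply: eq_bigr => i _; rewrite addnC.
Qed.

(* Even part of the alternating binomial sum centred at n: it annihilates
   q(k i^2) for deg q < n, which is where the square root in the degree comes
   from. *)
Definition central_weight (R : realFieldType) (n i : nat) : R :=
  (-1) ^+ i * 'C(n + n, n + i)%:R / 'C(n + n, n)%:R.

(** The composite of [q] with [k (X - n)^2] has degree less than [2n], so the alternating sum of
    order [2n] annihilates it. The terms at [n - i] and [n + i] agree, whence the factor 2, and
    dividing by the central term gives [q(0)] the coefficient 1. *)
Lemma central_weight_sum_eq0 (R : realFieldType) (n : nat) (k : R) (q : {poly R}) :
  (size q <= n)%N ->
  q.[0] + \sum_(i < n) 2 * central_weight R n i.+1 * q.[k * i.+1%:R ^+ 2] = 0.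
Proof.
move=> sq.
have C0 : ('C(n + n, n)%:R : R) != 0 by rewrite pnatr_eq0 -lt0n bin_gt0 leq_addr.
pose s : {poly R} := k *: ('X - n%:R%:P) ^+ 2.
have sE x : s.[x] = k * (x - n%:R) ^+ 2 by rewrite hornerZ horner_exp hornerXsubC.
have ss : (size s <= 3)%N.
  by apply: leq_trans (size_scale_leq _ _) _; rewrite size_exp_XsubC.
have sq' : (size (q \Po s) <= n + n)%N.
  have [->|q0] := eqVneq q 0; first by rewrite comp_poly0 size_poly0.
  apply: leq_trans (size_comp_poly_leq _ _) _.
  have : (0 < size q)%N by rewrite size_poly_gt0.
  by nia.
have := alternating_binomial_sum_eq0 sq'.
rewrite (sum_ord_centered n (fun j => (-1) ^+ j * 'C(n + n, j)%:R * (q \Po s).[j%:R])).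
move=> /(congr1 (fun x => (-1) ^+ n / 'C(n + n, n)%:R * x)); rewrite mulr0 => Z; rewrite -[RHS]Z {Z}.
have sgn : (-1) ^+ n * (-1) ^+ n = 1 :> R by rewrite -exprD addnn -mul2n exprM sqrrN !expr1n.
rewrite mulrDr mulr_sumr; congr (_ + _).
  rewrite horner_comp sE subrr expr0n mulr0.
  transitivity ((-1) ^+ n * (-1) ^+ n * q.[0]); first by rewrite sgn mul1r.
  by field.
apply: eq_bigr => i _.
have E j : ((j%:R : R) - n%:R) ^+ 2 = i.+1%:R ^+ 2 ->
    (q \Po s).[j%:R] = q.[k * i.+1%:R ^+ 2].
  by move=> e; rewrite horner_comp sE e.
rewrite !E; last 2 first.
- by rewrite natrD; ring.
- by rewrite natrB //; ring.
have -> : 'C(n + n, n - i.+1) = 'C(n + n, n + i.+1).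
  by rewrite -bin_sub; [congr 'C(_, _)|]; have := ltn_ord i; lia.
rewrite /central_weight exprD.
have -> : (-1) ^+ (n - i.+1) = (-1) ^+ n * (-1) ^+ i.+1 :> R.
  by rewrite -exprD -[LHS]signr_odd -[RHS]signr_odd oddB ?ltn_ord // oddD.
set a := (-1) ^+ n in sgn *.
transitivity ((a * a) * (2 * ((-1) ^+ i.+1 * 'C(n + n, n + i.+1)%:R / 'C(n + n, n)%:R) * q.[k * i.+1%:R ^+ 2])).
  by rewrite sgn mul1r.
by ring.
Qed.

Lemma oneBr_le_powR (R : realType) (x : R) : 0 <= x -> 1 - x <= 2 `^ (- x).
Proof.
move=> x0; rewrite /powR pnatr_eq0 /=; apply: le_trans (expR_ge1Dx _).
have l1 : ln (2 : R) <= 1.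
  by have := @le_ln1Dx R 1; rewrite -[1 + 1]/(2%:R); apply; lra.
by nra.
Qed.

(** The ratio of consecutive weights is [(n - i) / (n + i + 1) = 1 - (2i + 1) / (n + i + 1)] in
    absolute value. As [n + i + 1 <= 2n], it is at most [2^(-(2i + 1) / (2n))], and the odd numbers
    [2i + 1] add up to a square. *)
Lemma central_weight_norm_le (R : realType) (n i : nat) : (i <= n)%N ->
  `|central_weight R n i| <= 2 `^ (- (i%:R ^+ 2 / (2 * n%:R))).
Proof.
have C0 : (0 : R) < 'C(n + n, n)%:R by rewrite ltr0n bin_gt0 leq_addr.
have E j : `|central_weight R n j| = 'C(n + n, n + j)%:R / 'C(n + n, n)%:R.
  by rewrite /central_weight !normrM normr_sign mul1r normfV !ger0_norm // ltW.
elim: i => [|i IHi] lt_in.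
  by rewrite E addn0 divff ?gt_eqF // expr0n mul0r oppr0 powRr0.
have n0 : (0 : R) < n%:R by rewrite ltr0n; lia.
have iR : i%:R + 1 <= n%:R :> R by rewrite natr1 ler_nat.
have i0 : 0 <= i%:R :> R by [].
have -> : - (i.+1%:R ^+ 2 / (2 * n%:R)) =
    - (i%:R ^+ 2 / (2 * n%:R)) + - ((2 * i%:R + 1) / (2 * n%:R)) :> R.
  by rewrite -natr1; field; rewrite gt_eqF.
rewrite powRD; last by rewrite pnatr_eq0 implybT.
have step : `|central_weight R n i.+1| =
    `|central_weight R n i| * (1 - (2 * i%:R + 1) / (n%:R + i%:R + 1)).
  have /(congr1 (fun x => x%:R : R)) := mul_bin_left (n + n) (n + i).
  rewrite /= !natrM subnDl natrB 1?ltnW // -natr1 natrD => B.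
  have P : n%:R + i%:R + 1 != 0 :> R by rewrite gt_eqF //; lra.
  rewrite !E addnS; apply: (mulfI P).
  rewrite mulrA B; field.
  by rewrite P gt_eqF.
rewrite step; apply: ler_pM => //.
- rewrite subr_ge0 ler_pdivrMr; lra.
- by apply: IHi; rewrite ltnW.
apply: le_trans (oneBr_le_powR _); last by apply: divr_ge0; lra.
rewrite lerD2l lerN2; apply: ler_wpM2l; first lra.
by rewrite lef_pV2 ?posrE; lra.
Qed.

Lemma sum_inv_sqr_le2 (R : realFieldType) (n : nat) :
  \sum_(i < n) (i.+1%:R ^- 2 : R) <= 2.
Proof.
(* The sharper bound [2 - 1/n] is inductive from [n = 1] on. At [n = 0] it only says 2, because
   [0^-1 = 0], so [n = 1] is checked separately. *)
suff : \sum_(i < n) (i.+1%:R ^- 2 : R) <= 2 - n%:R^-1.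
  by move=> /le_trans; apply; rewrite gerBl invr_ge0.
elim: n => [|[|n] IHn]; first by rewrite big_ord0 invr0; lra.
  by rewrite big_ord1 expr1n invr1; lra.
rewrite big_ord_recr /=; apply: le_trans (lerD IHn (lexx _)) _.
rewrite -[n.+2%:R]natr1.
have : (1 : R) <= n.+1%:R by rewrite ler1n.
move: (n.+1%:R : R) => x x1.
rewrite -subr_ge0 (_ : _ - _ = (x * (x + 1) ^+ 2)^-1); last first.
  by field; rewrite !gt_eqF //; lra.
by rewrite invr_ge0 mulr_ge0 ?sqr_ge0 //; lra.
Qed.

(** * The atomic dual function: orthogonality, total mass and pointwise size *)

(** The profile in [Bstar] at [c = 1]. It is the value at [t + 1] of the [h] in the overview: laws
    on [{1, ..., r}] are indexed from 0 before being shifted. *)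
Definition envelope (R : realType) (alpha : R) (t : nat) : R :=
  ((t%:R + 1) ^+ 2 * 2 `^ (alpha * t%:R))^-1.

Lemma sum_ord_delta (R : pzRingType) (N a : nat) (c : R) (g : nat -> R) :
  (a < N)%N -> \sum_(t < N) (t == a :> nat)%:R * c * g t = c * g a.
Proof.
move=> aN; rewrite (bigD1 (Ordinal aN)) //= eqxx mul1r big1 ?addr0 // => t.
by rewrite -val_eqE /= => /negbTE ->; rewrite !mul0r.
Qed.

Definition atomic (R : pzRingType) (n : nat) (c0 c1 c3 : R) (c : nat -> R)
    (t : nat) : R :=
  (t == 0)%N%:R * c0 + (t == 1)%N%:R * c1 + (t == 3)%N%:R * c3 +
  \sum_(i < n) (t == 100 * i.+1 ^ 2)%N%:R * c i.

Lemma sum_atomic (R : pzRingType) (n r : nat) (c0 c1 c3 : R)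
    (c : nat -> R) (g : nat -> R) :
  (3 <= r)%N -> (100 * n ^ 2 <= r)%N ->
  \sum_(t < r.+1) atomic n c0 c1 c3 c t * g t =
  c0 * g 0 + c1 * g 1 + c3 * g 3 + \sum_(i < n) c i * g (100 * i.+1 ^ 2)%N.
Proof.
move=> r3 rn; under eq_bigr do rewrite /atomic !mulrDl.
rewrite !big_split /= !sum_ord_delta //; last by lia.
congr (_ + _); under eq_bigr do rewrite mulr_suml.
rewrite exchange_big /=; apply: eq_bigr => i _.
by rewrite sum_ord_delta //; have := ltn_ord i; nia.
Qed.

Lemma norm_atomic_le (R : realFieldType) (n : nat) (c0 c1 c3 : R)
    (c : nat -> R) (t : nat) :
  `|atomic n c0 c1 c3 c t| <=
  atomic n `|c0| `|c1| `|c3| (fun i => `|c i|) t.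
Proof.
have E (b : bool) (x : R) : `|b%:R * x| = b%:R * `|x|.
  by case: b; rewrite ?mul1r // !mul0r normr0.
rewrite /atomic -!E; apply: le_trans (ler_normD _ _) _.
apply: lerD.
  apply: le_trans (ler_normD _ _) _; apply: lerD => //; exact: ler_normD.
apply: le_trans (ler_norm_sum _ _ _) _.
by apply: ler_sum => i _; rewrite E.
Qed.

(** The points 1, 3 and [100 i^2] are pairwise distinct, so at most one term survives at each
    positive [t]. *)
Lemma atomic_le (R : realFieldType) (n : nat) (c0 c1 c3 b : R)
    (c : nat -> R) (t : nat) :
  (0 < t)%N -> 0 <= b -> (t = 1%N -> c1 <= b) -> (t = 3%N -> c3 <= b) ->
  (forall i, (i < n)%N -> t = (100 * i.+1 ^ 2)%N -> c i <= b) ->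
  atomic n c0 c1 c3 c t <= b.
Proof.
move=> t0 b0 b1 b3 bi; rewrite /atomic.
have -> : (t == 0)%N = false by lia.
have S0 : t = 1%N \/ t = 3%N -> \sum_(i < n) (t == 100 * i.+1 ^ 2)%N%:R * c i = 0.
  move=> t13; rewrite big1 // => i _.
  have -> : (t == 100 * i.+1 ^ 2)%N = false by nia.
  by rewrite mul0r.
have [t1|t1] := eqVneq t 1%N.
  by rewrite S0 ?t1; [rewrite mul0r mul1r mul0r !addr0 add0r b1|left].
have [t3|t3] := eqVneq t 3.
  by rewrite S0 ?t3; [rewrite mul0r mul1r mul0r !addr0 add0r b3|right].
rewrite !mul0r !add0r.
have [/existsP[i /eqP ti]|] := boolP [exists i : 'I_n, t == (100 * i.+1 ^ 2)%N].
  rewrite (bigD1 i) //= -ti eqxx mul1r big1 ?addr0 ?bi //.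
  move=> j; rewrite -val_eqE /= => ji.
  have -> : (t == 100 * j.+1 ^ 2)%N = false by nia.
  by rewrite mul0r.
rewrite negb_exists => /forallP N.
by rewrite big1 // => i _; rewrite (negbTE (N i)) mul0r.
Qed.

Lemma central_weight_norm_le1 (R : realType) (n i : nat) : (i <= n)%N ->
  `|central_weight R n i| <= 1.
Proof.
move=> ni; apply: le_trans (central_weight_norm_le R ni) _.
rewrite -[leRHS](powRr0 (2 : R)); apply: ler_powR; first lra.
by rewrite oppr_le0; apply: divr_ge0; rewrite ?sqr_ge0 ?mulr_ge0.
Qed.

Definition node (R : pzRingType) (i : nat) : R := 100 * i.+1%:R ^+ 2.

Lemma node_ge (R : realFieldType) (i : nat) : 97 * i.+1%:R ^+ 2 <= node R i - 3.
Proof.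
have i1 : (1 : R) <= i.+1%:R by rewrite ler1n.
by rewrite /node; nra.
Qed.

(* With D(g) = g(0) + sum_i 2 central_weight(i) g(node i), the masses at 0 and
   at the nodes are those of g |-> (3/2) D(g / ((x - 1) (x - 3))), which buys
   the decay 1/t^2; the masses at 1 and 3 are then forced by orthogonality to
   x - 3 and x - 1. *)
Definition dual_coef (R : realType) (n i : nat) : R :=
  3 * central_weight R n i.+1 / ((node R i - 1) * (node R i - 3)).

Definition dual_coef1 (R : realType) (n : nat) : R :=
  3 / 4 * (- 1 + \sum_(i < n) 2 * (central_weight R n i.+1 / (node R i - 1))).

Definition dual_coef3 (R : realType) (n : nat) : R :=
  3 / 4 * (1 / 3 - \sum_(i < n) 2 * (central_weight R n i.+1 / (node R i - 3))).

Definition dual_or (R : realType) (n : nat) : nat -> R :=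
  atomic n (1 / 2) (dual_coef1 R n) (dual_coef3 R n) (dual_coef R n).

Lemma dual_or0 (R : realType) (n : nat) : dual_or R n 0 = 1 / 2.
Proof.
have S0 : \sum_(i < n) (0 == 100 * i.+1 ^ 2)%N%:R * dual_coef R n i = 0.
  apply: big1 => i _.
  have -> : (0 == 100 * i.+1 ^ 2)%N = false by lia.
  by rewrite mul0r.
by rewrite /dual_or /atomic S0 /= 2!mul1r !mul0r !addr0.
Qed.

(** Divide [p] by [(x - 1)(x - 3)]. The quotient has degree below [n], so [central_weight_sum_eq0]
    removes it; the linear remainder is removed by the choice of the masses at 1 and 3. *)
Lemma dual_or_orth (R : realType) (n r : nat) (p : {poly R}) :
  (3 <= r)%N -> (100 * n ^ 2 <= r)%N -> (size p <= n.+2)%N ->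
  \sum_(t < r.+1) dual_or R n t * p.[t%:R] = 0.
Proof.
move=> r3 rn sp; rewrite (sum_atomic _ _ _ _ (fun t => p.[t%:R])) //.
pose d : {poly R} := ('X - 1%:P) * ('X - 3%:P).
have sd : size d = 3 by rewrite size_mul ?polyXsubC_eq0 // !size_XsubC.
have d0 : d != 0 by rewrite -size_poly_eq0 sd.
have dE x : d.[x] = (x - 1) * (x - 3) by rewrite hornerM !hornerXsubC.
set q := p %/ d; set s := p %% d.
have sq : (size q <= n)%N by rewrite /q size_divp // sd leq_subLR.
have ss : (size s <= 2)%N by have := ltn_modp p d; rewrite d0 sd ltnS.
have pE x : p.[x] = q.[x] * ((x - 1) * (x - 3)) + (s`_0 + s`_1 * x).
  rewrite {1}(divp_eq p d) hornerD hornerM dE; congr (_ + _).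
  rewrite (horner_coef_wide _ ss) !big_ord_recl big_ord0 /= /bump /=.
  by rewrite expr0 expr1 mulr1 addr0.
have D0 := central_weight_sum_eq0 100 sq.
pose A := \sum_(i < n) central_weight R n i.+1 / (node R i - 1).
pose B := \sum_(i < n) central_weight R n i.+1 / (node R i - 3).
pose Q := \sum_(i < n) 2 * central_weight R n i.+1 * q.[node R i].
(* Partial fractions: [2 / ((x - 1)(x - 3)) = 1/(x - 3) - 1/(x - 1)] and [2x / ((x - 1)(x - 3)) =
   3/(x - 3) - 1/(x - 1)]. *)
have -> : \sum_(i < n) dual_coef R n i * p.[(100 * i.+1 ^ 2)%N%:R] =
    3 / 2 * Q + s`_0 * (3 / 2 * (B - A)) + s`_1 * (3 / 2 * (3 * B - A)).
  rewrite /Q /A /B -sumrB !mulr_sumr -sumrB !mulr_sumr -!big_split /=.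
  apply: eq_bigr => i _; rewrite natrM natrX -/(node R i) pE /dual_coef.
  have := node_ge R i; have : (1 : R) <= i.+1%:R by rewrite ler1n.
  move: (node R i) => x i1 xi.
  by field; rewrite !gt_eqF //; nra.
rewrite /dual_coef1 /dual_coef3 -!mulr_sumr -/A -/B !pE.
have {}D0 : Q = - q.[0] by rewrite /Q -[LHS](addKr q.[0]) D0 addr0.
by rewrite D0; field.
Qed.

Lemma sum_inv_node_le (R : realType) (n : nat) :
  \sum_(i < n) (97 * i.+1%:R ^+ 2)^-1 <= 2 / 97 :> R.
Proof.
under eq_bigr do rewrite invfM.
by rewrite -mulr_sumr mulrC ler_wpM2r // sum_inv_sqr_le2.
Qed.

Lemma node_sum_norm_le (R : realType) (n : nat) (a : R) : 1 <= a <= 3 ->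
  `|\sum_(i < n) 2 * (central_weight R n i.+1 / (node R i - a))| <= 4 / 97.
Proof.
move=> /andP[a1 a3]; apply: le_trans (ler_norm_sum _ _ _) _.
have -> : 4 / 97 = 2 * (2 / 97) :> R by lra.
apply: le_trans (ler_wpM2l _ (sum_inv_node_le R n)) => //.
rewrite mulr_sumr; apply: ler_sum => i _.
rewrite normrM [`|2|]ger0_norm // ler_wpM2l // normrM normfV.
have i1 : (1 : R) <= i.+1%:R by rewrite ler1n.
have xi := node_ge R i.
rewrite -[leRHS]mul1r; apply: ler_pM => //.
- exact: central_weight_norm_le1.
rewrite ger0_norm; last by nra.
by rewrite lef_pV2 ?posrE; nra.
Qed.

Lemma dual_coef1_norm_le (R : realType) (n : nat) :
  `|dual_coef1 R n| <= 3 / 4 * (1 + 4 / 97).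
Proof.
rewrite normrM [`|3 / 4|]ger0_norm; last lra.
rewrite ler_wpM2l //.
apply: le_trans (ler_normD _ _) _; rewrite normrN1 lerD2l.
by apply: node_sum_norm_le; lra.
Qed.

Lemma dual_coef3_norm_le (R : realType) (n : nat) :
  `|dual_coef3 R n| <= 3 / 4 * (1 / 3 + 4 / 97).
Proof.
rewrite normrM [`|3 / 4|]ger0_norm; last lra.
rewrite ler_wpM2l //.
apply: le_trans (ler_normB _ _) _; rewrite ger0_norm; last lra.
by rewrite lerD2l; apply: node_sum_norm_le; lra.
Qed.

Lemma dual_coef_norm (R : realType) (n i : nat) :
  `|dual_coef R n i| =
  3 * `|central_weight R n i.+1| / ((node R i - 1) * (node R i - 3)).
Proof.
have i1 : (1 : R) <= i.+1%:R by rewrite ler1n.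
have xi := node_ge R i.
rewrite normrM normfV normrM [`|3|]ger0_norm // [X in _ / X]ger0_norm //.
by rewrite mulr_ge0; nra.
Qed.

(** The masses at 1 and 3 contribute at most [1 + 6/97] and the nodes at most [6/97]. The wide
    spacing factor 100 keeps the total below [3/2], which is what makes the constant [K] of
    [moment_matching_exists] positive. *)
Lemma dual_or_sum_norm_le (R : realType) (n r : nat) :
  (3 <= r)%N -> (100 * n ^ 2 <= r)%N ->
  \sum_(t < r) `|dual_or R n t.+1| <= 5 / 4.
Proof.
move=> r3 rn.
(* Adding the mass [1/2] at 0 to both sides brings the sum into the form of [sum_atomic]. *)
have : \sum_(t < r.+1) `|dual_or R n t| <= 1 / 2 + 5 / 4; last first.
  by rewrite big_ord_recl dual_or0 [`|1 / 2|]ger0_norm; [rewrite lerD2l|lra].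
apply: (@le_trans _ _ (\sum_(t < r.+1) atomic n `|1 / 2| `|dual_coef1 R n|
    `|dual_coef3 R n| (fun i => `|dual_coef R n i|) t * 1)).
  by apply: ler_sum => t _; rewrite mulr1; exact: norm_atomic_le.
rewrite (sum_atomic _ _ _ _ (fun=> 1)) // !mulr1.
have S : \sum_(i < n) `|dual_coef R n i| * 1 <= 3 * (2 / 97).
  apply: le_trans (ler_wpM2l _ (sum_inv_node_le R n)) => //.
  rewrite mulr_sumr; apply: ler_sum => i _.
  have i1 : (1 : R) <= i.+1%:R by rewrite ler1n.
  have xi := node_ge R i.
  rewrite mulr1 dual_coef_norm -mulrA ler_wpM2l //.
  rewrite -[leRHS]mul1r; apply: ler_pM => //.
  - by rewrite invr_ge0 mulr_ge0; nra.
  - exact: central_weight_norm_le1.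
  rewrite lef_pV2 ?posrE; [|by apply: mulr_gt0; nra|nra].
  have i2 : (1 : R) <= i.+1%:R ^+ 2 by nra.
  by apply: (le_trans xi); apply: ler_peMl; lra.
have := dual_coef1_norm_le R n; have := dual_coef3_norm_le R n.
rewrite [`|1 / 2|]ger0_norm; lra.
Qed.

Lemma envelope_gt0 (R : realType) (alpha : R) (t : nat) : 0 < envelope alpha t.
Proof.
by rewrite invr_gt0 mulr_gt0 ?powR_gt0 // exprn_gt0 // natr1 ltr0n.
Qed.

(** At a node [x = 100 i^2] the Gaussian bound [2^(-i^2 / (2n))] is at most [2^(-alpha x)] exactly
    because [200 n alpha <= 1], and [1 / ((x - 1)(x - 3)) <= 2 / x^2], giving the constant 6. The
    points 1 and 3 also fit under 18. *)
Lemma dual_or_norm_le (R : realType) (n t : nat) (alpha : R) :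
  (0 < n)%N -> 0 <= alpha -> 200 * n%:R * alpha <= 1 ->
  `|dual_or R n t.+1| <= 18 * envelope alpha t.
Proof.
move=> n0 a0 na; apply: le_trans (norm_atomic_le _ _ _ _ _ _) _.
have n1 : (1 : R) <= n%:R by rewrite ler1n.
have e0 := envelope_gt0 alpha t.
apply: atomic_le => //.
- by rewrite mulr_ge0 // ltW.
- case=> ->; rewrite /envelope mulr0 powRr0 mulr1 add0r expr1n invr1.
  by have := dual_coef1_norm_le R n; lra.
- case=> ->; rewrite /envelope.
  have e4 : 2 `^ (alpha * 2) <= 4 :> R.
    have -> : 4 = 2 `^ 2%:R :> R by rewrite powR_mulrn //; lra.
    by apply: ler_powR; nra.
  have e1 : 0 < 2 `^ (alpha * 2) :> R by rewrite powR_gt0.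
  apply: le_trans (dual_coef3_norm_le R n) _.
  rewrite ler_pdivlMr; last by rewrite mulr_gt0 // exprn_gt0.
  by nra.
move=> i lt_in ti; rewrite dual_coef_norm.
have i1 : (1 : R) <= i.+1%:R by rewrite ler1n.
have tx : t%:R + 1 = node R i by rewrite natr1 ti natrM natrX.
have i2 : (1 : R) <= i.+1%:R ^+ 2 by nra.
have x100 : 100 <= node R i by rewrite /node; nra.
have W : `|central_weight R n i.+1| <= (2 `^ (alpha * t%:R))^-1.
  apply: le_trans (central_weight_norm_le R lt_in) _; rewrite -powRN.
  apply: ler_powR; first lra.
  rewrite lerN2 ler_pdivlMr; last by lra.
  apply: (@le_trans _ _ (200 * n%:R * alpha * i.+1%:R ^+ 2)).
    have : t%:R <= node R i by lra.
    rewrite /node => tle.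
    have := ler_wpM2l (mulr_ge0 a0 (ler0n R n)) tle; lra.
  by rewrite -[leRHS]mul1r ler_wpM2r //; lra.
have K : ((node R i - 1) * (node R i - 3))^-1 <= 2 / node R i ^+ 2.
  rewrite ler_pdivlMr; last by apply: exprn_gt0; lra.
  by rewrite mulrC ler_pdivrMr; [nra|apply: mulr_gt0; lra].
have x0 : 0 <= node R i ^- 2 by rewrite invr_ge0 sqr_ge0.
rewrite /envelope tx [in leRHS]invfM -[leLHS]mulrA.
apply: (@le_trans _ _ (3 * ((2 `^ (alpha * t%:R))^-1 * (2 / node R i ^+ 2)))).
  rewrite ler_wpM2l //; apply: ler_pM => //.
  by rewrite invr_ge0 mulr_ge0; lra.
have : 0 <= (2 `^ (alpha * t%:R))^-1 * node R i ^- 2.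
  by rewrite mulr_ge0 // invr_ge0 powR_ge0.
lra.
Qed.

Lemma dual_or_exists (R : realType) (r : nat) (alpha := 20^-1 / Num.sqrt r%:R : R) :
  (0 < r)%N ->
  exists w : nat -> R,
    [/\ w 0 = 1 / 2,
        forall t, `|w t.+1| <= 18 * envelope alpha t,
        \sum_(t < r) `|w t.+1| <= 5 / 4 &
        forall k, k%:R < 100^-1 * Num.sqrt r%:R :> R ->
          \sum_(t < r.+1) w t * t%:R ^+ k = 0].
Proof.
move=> r0; have sr0 : 0 < Num.sqrt r%:R :> R by rewrite sqrtr_gt0 ltr0n.
have sr2 : Num.sqrt r%:R ^+ 2 = r%:R :> R by rewrite sqr_sqrtr.
(* This [n] is the integer part of [sqrt(r) / 10], so the last node is at most [r] and
   [200 n alpha = 10 n / sqrt(r) <= 1]. *)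
have [n /andP[rn rn1]] : exists n, (100 * n ^ 2 <= r < 100 * n.+1 ^ 2)%N.
  elim: r {r0 sr0 sr2 alpha} => [|r [n /andP[rn rn1]]]; first by exists 0.
  have [h|h] := ltnP r.+1 (100 * n.+1 ^ 2); [exists n|exists n.+1]; nia.
have rnR : 100 * n%:R ^+ 2 <= r%:R :> R by rewrite -natrX -natrM ler_nat.
have rn1R : r%:R < 100 * (n%:R + 1) ^+ 2 :> R.
  by rewrite natr1 -natrX -natrM ltr_nat.
have n0R : 0 <= n%:R :> R by [].
have s1 : Num.sqrt r%:R < 10 * (n%:R + 1) :> R by nra.
have s2 : 10 * n%:R <= Num.sqrt r%:R :> R by nra.
(* If [n = 0] then [sqrt(r) < 10], so only the moment [k = 0] is at stake and two opposite masses at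
   0 and 1 suffice. *)
have [n0|n0] := posnP n.
  pose w (t : nat) : R := (t == 0)%N%:R * (1 / 2) + (t == 1)%N%:R * (- (1 / 2)).
  exists w; split.
  - by rewrite /w /=; lra.
  - case=> [|t]; rewrite /w /= ?mul0r ?mul1r ?add0r.
      rewrite /envelope mulr0 powRr0 mulr1 add0r expr1n invr1 normrN ger0_norm; lra.
    by rewrite normr0 mulr_ge0 // ltW // envelope_gt0.
  - case: r r0 {rn rn1 rnR rn1R s1 s2 sr0 sr2 alpha} => // r _.
    rewrite big_ord_recl big1 /w /= ?mul0r ?mul1r ?add0r ?addr0.
      by rewrite normrN ger0_norm; lra.
    by move=> t _; rewrite ?mul0r ?addr0 normr0.
  - move=> k hk.
    have -> : k = 0%N.
      apply/eqP; rewrite -leqn0 -ltnS -(ltr_nat R).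
      by rewrite n0 in s1; lra.
    case: r r0 {rn rn1 rnR rn1R s1 s2 sr0 sr2 alpha hk} => // r _.
    rewrite !big_ord_recl big1 /w /= ?expr0 ?mul0r ?mul1r ?mulr1 ?add0r ?addr0 ?subrr //.
    by move=> t _; rewrite ?mul0r ?addr0 ?mul0r.
have r3 : (3 <= r)%N by nia.
have n1R : 1 <= n%:R :> R by rewrite ler1n.
exists (dual_or R n); split.
- exact: dual_or0.
- move=> t; apply: dual_or_norm_le => //; first by rewrite divr_ge0 //; lra.
  rewrite /alpha mulrA ler_pdivrMr //; lra.
- exact: dual_or_sum_norm_le.
(* Here [k < sqrt(r) / 100 < (n + 1) / 10 <= n]. *)
- move=> k hk; have kn : (k <= n)%N by rewrite -(ler_nat R); lra.
  have := @dual_or_orth R n r 'X^k r3 rn; rewrite size_polyXn => H.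
  rewrite -[RHS]H; last by lia.
  by apply: eq_bigr => t _; rewrite hornerXn.
Qed.

(** * The pair of laws with matching moments *)

Lemma sum_envelope_bounds (R : realType) (r : nat) (alpha : R) :
  (0 < r)%N -> 0 <= alpha -> 1 <= \sum_(t < r) envelope alpha t <= 2.
Proof.
move=> r0 a0; apply/andP; split.
  case: r r0 => // r _; rewrite big_ord_recl /= {1}/envelope.
  rewrite mulr0 powRr0 mulr1 add0r expr1n invr1 lerDl.
  by apply: sumr_ge0 => t _; rewrite ltW // envelope_gt0.
apply: le_trans (sum_inv_sqr_le2 R r); apply: ler_sum => t _.
rewrite /envelope natr1 lef_pV2 ?posrE.
- rewrite ler_peMr ?sqr_ge0 // -[leLHS](powRr0 (2 : R)).
  by apply: ler_powR; [lra|rewrite mulr_ge0].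
- by rewrite mulr_gt0 ?exprn_gt0 ?powR_gt0.
- by rewrite exprn_gt0.
Qed.

(** Here [l t] is the mass at [t + 1] of a law on [{1, ..., r}], and 100 is the inverse of the final
    constant [c1]. *)
Definition near_envelope (R : realType) (r : nat) (alpha : R) (l : nat -> R) :=
  [/\ forall t, (t < r)%N ->
        100^-1 * envelope alpha t <= l t <= 100 * envelope alpha t,
      forall t, (r <= t)%N -> l t = 0 & \sum_(t < r) l t = 1].

(** The construction gives [l1 - l2 / 2 = -w] on positive points. Since [w] is orthogonal to low
    powers and has mass [1/2] at 0, the moments of [-w] there are half those of the point mass at
    0. *)
Lemma moment_matching_exists (R : realType) (r : nat)
    (alpha := 20^-1 / Num.sqrt r%:R : R) :
  (0 < r)%N ->
  exists l1 l2 : nat -> R,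
    [/\ near_envelope r alpha l1, near_envelope r alpha l2 &
        forall k, k%:R < 100^-1 * Num.sqrt r%:R :> R ->
          \sum_(t < r) l1 t * t.+1%:R ^+ k =
          ((k == 0)%N%:R + \sum_(t < r) l2 t * t.+1%:R ^+ k) / 2].
Proof.
move=> r0; have sr0 : 0 < Num.sqrt r%:R :> R by rewrite sqrtr_gt0 ltr0n.
have [w [w0 wle wsum worth]] := dual_or_exists R r0.
have a0 : 0 <= alpha by rewrite divr_ge0 //; lra.
have /andP[H1 H2] := sum_envelope_bounds r0 a0.
set H := \sum_(t < r) envelope alpha t in H1 H2.
set P := \sum_(t < r) `|w t.+1| in wsum.
have P0 : 0 <= P by apply: sumr_ge0.
have worth' k : k%:R < 100^-1 * Num.sqrt r%:R :> R ->
    \sum_(t < r) w t.+1 * t.+1%:R ^+ k = - ((k == 0)%N%:R / 2).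
  move=> /worth; rewrite big_ord_recl w0 expr0n /= => /eqP.
  by rewrite addr_eq0 => /eqP E; rewrite -[LHS]opprK -E; lra.
have Sw : \sum_(t < r) w t.+1 = - (1 / 2).
  have := worth' 0%N; rewrite eqxx /= => <-; last by rewrite mulr_gt0.
  by apply: eq_bigr => t _; rewrite expr0 mulr1.
(* [K] gives [l1] total mass 1; then [l2] has mass [P - 1/2 + 2 K H = 1] too. The bounds on [P] and
   [H] yield [1/16 <= K <= 1], so both laws lie between [h / 16] and [38 h]. *)
pose K := (1 - (P + 1 / 2) / 2) / H.
have H0 : 0 < H by lra.
have K1 : K <= 1 by rewrite ler_pdivrMr; lra.
have K2 : 16^-1 <= K by rewrite ler_pdivlMr; lra.
have KH : K * H = 1 - (P + 1 / 2) / 2 by rewrite divfK // gt_eqF.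
exists (fun t => if (t < r)%N then (`|w t.+1| - w t.+1) / 2 + K * envelope alpha t else 0).
exists (fun t => if (t < r)%N then `|w t.+1| + w t.+1 + 2 * (K * envelope alpha t) else 0).
split.
- split => [t tr|t tr|].
  + rewrite tr; have := wle t; have := envelope_gt0 alpha t.
    have := ler_norm (w t.+1); have := ler_norm (- w t.+1); rewrite normrN.
    move: (envelope _ _) => e ? ? ? ?; apply/andP; split; nra.
  + by rewrite ltnNge tr.
  + under eq_bigr do rewrite ltn_ord.
    by rewrite big_split /= -mulr_suml -mulr_sumr sumrB -/P -/H KH Sw; lra.
- split => [t tr|t tr|].
  + rewrite tr; have := wle t; have := envelope_gt0 alpha t.
    have := ler_norm (w t.+1); have := ler_norm (- w t.+1); rewrite normrN.
    move: (envelope _ _) => e ? ? ? ?; apply/andP; split; nra.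
  + by rewrite ltnNge tr.
  + under eq_bigr do rewrite ltn_ord.
    by rewrite !big_split /= -!mulr_sumr -/P -/H KH Sw; lra.
move=> k /worth' E.
under eq_bigr do rewrite ltn_ord.
under [in RHS]eq_bigr do rewrite ltn_ord.
have -> : (k == 0)%N%:R = - (2 * \sum_(t < r) w t.+1 * t.+1%:R ^+ k) :> R by rewrite E; lra.
rewrite mulr_sumr -sumrN -big_split mulr_suml /=.
by apply: eq_bigr => t _; lra.
Qed.

(** * Finitely supported sums, sums over the grid, and the weights of odd sets *)

Lemma fsbig_finite_image (V : nmodType) (T : choiceType) (I : finType)
    (g : I -> T) (f : T -> V) :
  injective g -> (forall x, f x != 0 -> exists i, x = g i) ->
  \sum_(x \in [set: T]) f x = \sum_i f (g i).
Proof.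
move=> gi fg; rewrite (fsbigE [seq g i | i <- index_enum I]) //.
- by rewrite big_map; apply: eq_bigl => i; rewrite in_setT.
- by rewrite map_inj_uniq ?index_enum_uniq.
move=> x _ xr; apply/eqP/negPn/negP => /fg[i xi]; move/negP: xr; apply.
by rewrite xi map_f ?mem_index_enum.
Qed.

Lemma esum_finite_image (R : realType) (T : choiceType) (I : finType)
    (g : I -> T) (f : T -> R) :
  injective g -> (forall x, 0 <= f x) ->
  (forall x, f x != 0 -> exists i, x = g i) ->
  \esum_(x in [set: T]) (f x)%:E = (\sum_i f (g i))%:E.
Proof.
move=> gi f0 fg.
have gr x : x \notin range g -> f x = 0.
  move=> xr; apply/eqP/negPn/negP => /fg[i xi]; move/negP: xr; apply.
  by rewrite inE xi; exists i.
transitivity (\esum_(x in range g) (f x)%:E).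
  rewrite [RHS]esum_mkcond; apply: eq_esum => x _.
  by case: ifPn => // /gr ->.
rewrite esum_image; last by move=> x y _ _; exact: gi.
rewrite esum_fset; [|exact: finite_finset|by move=> i _; rewrite lee_fin].
rewrite (fsbigE (index_enum I)) ?index_enum_uniq //; last by move=> i _; rewrite mem_index_enum.
by rewrite -sumEFin; apply: eq_bigl => i; rewrite in_setT.
Qed.

Lemma is_distr_nat (R : realType) (N : nat) (f : nat -> R) :
  (forall t, 0 <= f t) -> (forall t, (N <= t)%N -> f t = 0) ->
  \sum_(t < N) f t = 1 -> is_distr f.
Proof.
move=> f0 fN f1; split => //.
rewrite (@esum_finite_image _ _ 'I_N val) //; first by rewrite f1.
move=> t; have [Nt|tN _] := leqP N t; first by rewrite fN ?eqxx.
  by exists (Ordinal tN).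
Qed.

Lemma grid_incl_inj (m r : nat) : injective (@grid_incl m r).
Proof. by move=> x y /ffunP e; apply/ffunP => i; have := e i; rewrite !ffunE => /val_inj. Qed.

Lemma grid_inclP (m r : nat) (x : {ffun 'I_m -> nat}) :
  (forall i, (x i <= r)%N) -> exists t : {ffun 'I_m -> 'I_r.+1}, x = grid_incl t.
Proof.
move=> xr; exists [ffun i => inord (x i)]; apply/ffunP => i.
by rewrite !ffunE inordK // ltnS.
Qed.

Lemma sum_grid_prod (R : comPzRingType) (m r : nat) (a : 'I_m -> nat -> R) :
  \sum_(t : {ffun 'I_m -> 'I_r.+1}) \prod_i a i (grid_incl t i) =
  \prod_i \sum_(j < r.+1) a i j.
Proof.
rewrite bigA_distr_bigA; apply: eq_bigr => t _.
by apply: eq_bigr => i _; rewrite ffunE.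
Qed.

(* This is 2^(1-m) if f takes the value true an odd number of times, and 0
   otherwise. *)
Definition odd_weight (R : realFieldType) (m : nat) (f : {ffun 'I_m -> bool}) : R :=
  2 ^- m * (1 - \prod_i (-1) ^+ f i).

Lemma odd_weight_ge0 (R : realFieldType) (m : nat) (f : {ffun 'I_m -> bool}) :
  0 <= odd_weight R f.
Proof.
rewrite mulr_ge0 ?invr_ge0 ?exprn_ge0 // subr_ge0.
apply: le_trans (ler_norm _) _; rewrite normr_prod.
by rewrite big1 // => i _; rewrite normr_sign.
Qed.

(** Expand both products over all [f]: the second expansion carries the sign [(-1)] to the number of
    true values of [f], which is the sign inside [odd_weight]. *)
Lemma odd_weight_sum (R : realFieldType) (m : nat) (a : bool -> 'I_m -> R) :
  \sum_(f : {ffun 'I_m -> bool}) odd_weight R f * \prod_i a (f i) i =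
  2 ^- m * (\prod_i (a false i + a true i) - \prod_i (a false i - a true i)).
Proof.
have E (F : 'I_m -> bool -> R) :
    \prod_i (F i true + F i false) = \sum_(f : {ffun 'I_m -> bool}) \prod_i F i (f i).
  by rewrite -bigA_distr_bigA; apply: eq_bigr => i _; rewrite big_bool.
have -> : \prod_i (a false i + a true i) =
    \sum_(f : {ffun 'I_m -> bool}) \prod_i a (f i) i.
  by rewrite -(E (fun i b => a b i)); apply: eq_bigr => i _; rewrite addrC.
have -> : \prod_i (a false i - a true i) =
    \sum_(f : {ffun 'I_m -> bool}) \prod_i ((-1) ^+ f i * a (f i) i).
  rewrite -(E (fun i b => (-1) ^+ b * a b i)); apply: eq_bigr => i _ /=.
  by rewrite expr0 expr1; ring.
rewrite -sumrB mulr_sumr; apply: eq_bigr => f _.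
by rewrite big_split /= /odd_weight; ring.
Qed.

Lemma odd_weight_sum1 (R : realFieldType) (m : nat) : (0 < m)%N ->
  \sum_(f : {ffun 'I_m -> bool}) odd_weight R f = 1.
Proof.
move=> m0; transitivity (\sum_(f : {ffun 'I_m -> bool}) odd_weight R f * \prod_(i < m) 1).
  by apply: eq_bigr => f _; rewrite big1_eq mulr1.
(* With all factors 1 the sum is [2^-m (2^m - 0^m)], and [0^m = 0] because [m] is positive. *)
rewrite (odd_weight_sum (fun _ _ => 1)) !prodr_const card_ord subrr expr0n.
by rewrite (gtn_eqF m0) subr0 mulVf // expf_neq0 // pnatr_eq0.
Qed.

Lemma odd_weight_neq0 (R : realFieldType) (m : nat) (f : {ffun 'I_m -> bool}) :
  odd_weight R f != 0 -> exists i, f i.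
Proof.
move=> w0; apply/existsP; apply: contraNT w0; rewrite negb_exists => /forallP nf.
rewrite /odd_weight big1 ?subrr ?mulr0 // => i _.
by rewrite (negbTE (nf i)).
Qed.

(** * Membership of the one-dimensional laws and of mixtures in the required families *)

Lemma conv_finType (R : realType) (T : Type) (I : finType) (S : set (T -> R))
    (w : I -> R) (g : I -> T -> R) (L : T -> R) :
  (forall k, 0 <= w k) -> \sum_k w k = 1 -> (forall k, S (g k)) ->
  (forall x, L x = \sum_k w k * g k x) -> conv S L.
Proof.
move=> w0 w1 Sg LE; have E (F : I -> R) : \sum_k F k = \sum_(i < #|I|) F (enum_val i).
  by rewrite -big_enum_val.
exists #|I|, (w \o enum_val), (g \o enum_val); split => //=.
- by rewrite -E.
- by move=> x; rewrite LE E.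
Qed.

Definition shift1 (R : realType) (l : nat -> R) (t : nat) : R :=
  if (1 <= t)%N then l (t - 1)%N else 0.

Definition point0 (R : realType) (t : nat) : R := (t == 0)%N%:R.

(** Take [r' = 0] and no shift: only [t = 0] is tested, where the bounds read [c <= 1 <= 1/c]. *)
Lemma Bstar_shift_point0 (R : realType) (r : nat) (c alpha : R) (Delta : nat) :
  0 < c <= 1 -> Bstar_shift r c alpha Delta (point0 R).
Proof.
move=> /andP[c0 c1]; have d : is_distr (point0 R).
  apply: (@is_distr_nat _ 1) => [t|[]//|]; first by rewrite ler0n.
  by rewrite big_ord1.
split=> //; exists (point0 R), 0%N; split => //; last by move=> t; rewrite subn0.
split => //.
  exists 0%N => //; apply/seteqP; split => t; rewrite /supp /point0 /= leqn0.
    by case: (t == 0)%N; rewrite ?eqxx.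
  by move=> ->; rewrite oner_neq0.
case=> [_|t]; last by rewrite /supp /point0 /= eqxx.
rewrite /point0 /= mulr0 powRr0 add0r expr1n !mulr1 invr1 mulr1 c1 /=.
by rewrite div1r invf_ge1.
Qed.

Lemma Bstar_shift1 (R : realType) (r : nat) (alpha : R) (l : nat -> R) :
  (0 < r)%N -> near_envelope r alpha l ->
  Bstar_shift r 100^-1 alpha 1 (shift1 l).
Proof.
move=> r0 [lb l0 l1].
have l_gt0 t : (t < r)%N -> 0 < l t.
  move=> /lb/andP[+ _]; apply: lt_le_trans; rewrite mulr_gt0 ?envelope_gt0 //.
have l_ge0 t : 0 <= l t.
  by have [/l0 ->//|/l_gt0/ltW] := leqP r t.
split.
  apply: (@is_distr_nat _ r.+1) => [[|t]|[//|t] rt|].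
  - by [].
  - exact: l_ge0.
  - by rewrite /shift1 subn1 /= l0.
  by rewrite big_ord_recl /shift1 /= add0r -l1; apply: eq_bigr => t _; rewrite subn1.
(* The unshifted law has support [{0, ..., r - 1}], so [r' = r - 1]; the shift by 1 moves it off
   0. *)
exists l, 1%N; split => //; split.
- exact: (is_distr_nat l_ge0 l0 l1).
- exists r.-1; first by rewrite leq_pred.
  apply/seteqP; split => t; rewrite /supp /=.
    apply: contraNT; rewrite -ltnNge => h; rewrite l0 //; lia.
  by move=> h; rewrite gt_eqF // l_gt0 //; lia.
- move=> t; rewrite /supp /= => lt0; have tr : (t < r)%N.
    by move: lt0; apply: contraNT; rewrite -leqNgt => /l0 ->.
  have := lb t tr; rewrite /envelope.
  by rewrite div1r -[100^-1 * _ * _]mulrA [(100^-1 * _)^-1]invfM invrK.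
Qed.

(** * Moments of the product law and of the odd mixture *)

Lemma shift1_moment (R : realType) (r k : nat) (l : nat -> R) :
  \sum_(j < r.+1) shift1 l j * j%:R ^+ k = \sum_(t < r) l t * t.+1%:R ^+ k.
Proof.
rewrite big_ord_recl {1}/shift1 /= mul0r add0r; apply: eq_bigr => t _.
by rewrite /shift1 /= subn1.
Qed.

Lemma point0_moment (R : realType) (r k : nat) :
  \sum_(j < r.+1) point0 R j * j%:R ^+ k = (k == 0)%N%:R.
Proof.
rewrite big_ord_recl big1 ?addr0; last by move=> t _; rewrite /point0 /= mul0r.
by rewrite /point0 eqxx mul1r expr0n.
Qed.

Lemma grid_sum_prod_moment (R : comPzRingType) (m r : nat) (a : 'I_m -> nat -> R)
    (k : 'I_m -> nat) :
  \sum_(t : {ffun 'I_m -> 'I_r.+1})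
    (\prod_i a i (grid_incl t i)) * \prod_i (grid_incl t i)%:R ^+ k i =
  \prod_i \sum_(j < r.+1) a i j * j%:R ^+ k i.
Proof.
rewrite -(sum_grid_prod _ (fun i j => a i j * j%:R ^+ k i)).
by apply: eq_bigr => t _; rewrite big_split.
Qed.

Definition product_law (R : realType) (m : nat) (l : nat -> R)
    (x : {ffun 'I_m -> nat}) : R :=
  \prod_i l (x i).

Definition odd_mixture (R : realType) (m : nat) (l0 l2 : nat -> R)
    (x : {ffun 'I_m -> nat}) : R :=
  \sum_(f : {ffun 'I_m -> bool})
    odd_weight R f * \prod_i (if f i then l0 else l2) (x i).

(** Moments factor over coordinates, so [odd_weight_sum] writes the moment of the mixture as a
    difference of two products. The second contains a zero factor, at a coordinate of exponent 0;
    the first agrees with the moment of [product_law] factor by factor. *)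
Lemma product_odd_mixture_orth (R : realType) (m r : nat) (l0 l1 l2 : nat -> R)
    (k : 'I_m -> nat)
    (M := fun (l : nat -> R) n => \sum_(j < r.+1) l j * j%:R ^+ n) :
  (forall i, M l1 (k i) = (M l0 (k i) + M l2 (k i)) / 2) ->
  M l0 0%N = M l2 0%N -> (\sum_i k i < m)%N ->
  \sum_(t : {ffun 'I_m -> 'I_r.+1})
    (product_law l1 (grid_incl t) - odd_mixture l0 l2 (grid_incl t)) *
    \prod_i (grid_incl t i)%:R ^+ k i = 0.
Proof.
move=> M1 M0 km.
under eq_bigr do rewrite mulrBl.
rewrite sumrB (grid_sum_prod_moment r (fun=> l1)).
under [X in _ - X]eq_bigr do rewrite mulr_suml.
rewrite exchange_big /=.
under [X in _ - X]eq_bigr => f _.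
  under eq_bigr do rewrite -mulrA.
  rewrite -mulr_sumr (grid_sum_prod_moment r (fun i => if f i then l0 else l2)).
  over.
rewrite (odd_weight_sum (fun b i => M (if b then l0 else l2) (k i))) /=.
(* If all [m] exponents were positive, their sum would be at least [m]. *)
have [i0 ki0] : exists i, k i = 0%N.
  suff /existsP[i /eqP ki] : [exists i, k i == 0%N] by exists i.
  apply: contraLR km; rewrite negb_exists => /forallP k0.
  rewrite -leqNgt -[leqLHS]muln1 -[in leqLHS](card_ord m) -sum_nat_const.
  by apply: leq_sum => i _; rewrite lt0n.
have -> : \prod_i (M l2 (k i) - M l0 (k i)) = 0.
  by rewrite (bigD1 i0) //= ki0 M0 subrr mul0r.
rewrite subr0; apply/eqP; rewrite subr_eq0; apply/eqP.
transitivity (\prod_i ((M l2 (k i) + M l0 (k i)) * 2^-1)).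
  by apply: eq_bigr => i _; rewrite -/(M _ _) M1 addrC.
by rewrite big_split /= prodr_const card_ord -exprVn mulrC.
Qed.

(** Used on the list of monomials of a polynomial, where the maximum is its [total_degree]. *)
Lemma sum_deg_le_eq0 (V : nmodType) (T : Type) (s : seq T) (deg : T -> nat)
    (F : T -> V) (d : nat) :
  (forall x, (deg x <= d)%N -> F x = 0) -> (\max_(y <- s) deg y <= d)%N ->
  \sum_(x <- s) F x = 0.
Proof.
move=> F0; elim: s => [|x s IHs]; first by rewrite !big_nil.
by rewrite !big_cons geq_max => /andP[/F0 -> /IHs ->]; rewrite addr0.
Qed.

Lemma poly_pairing_grid (R : realType) (m r : nat) (phi : {ffun 'I_m -> nat} -> R)
    (p : mpoly.mpoly m R) :
  (forall x, phi x != 0 -> exists t : {ffun 'I_m -> 'I_r.+1}, x = grid_incl t) ->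
  (forall k : 'I_m -> nat, (\sum_i k i <= total_degree p)%N ->
     \sum_(t : {ffun 'I_m -> 'I_r.+1})
       phi (grid_incl t) * \prod_i (grid_incl t i)%:R ^+ k i = 0) ->
  poly_pairing phi p = 0.
Proof.
move=> phir phik; rewrite /poly_pairing (fsbig_finite_image (@grid_incl_inj m r)); last first.
  move=> x nz; apply: phir; apply: contraNneq nz => ->; by rewrite mul0r.
under eq_bigr do rewrite mpoly.mevalE mulr_sumr.
rewrite exchange_big /=.
apply: (sum_deg_le_eq0 (deg := @mpoly.mdeg m) _ (leqnn _)) => mon mond.
under eq_bigr do rewrite mulrCA.
by rewrite -mulr_sumr phik ?mulr0 // -mpoly.mdegE.
Qed.

Theorem theorem4p4 (R : realType) :
  exists c1 c2 : R,
    [/\ 0 < c1 < 1, 0 < c2 < 1 &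
      forall m r : nat, (0 < m)%N -> (0 < r)%N ->
        exists Lambda : bool -> {ffun 'I_m -> nat} -> R,
          (forall i : bool,
             [/\ is_distr (Lambda i),
                 conv (tensor_power
                         (Bstar_shift r c1 (c2 / Num.sqrt r%:R) 1) m)
                   (Lambda i) &
                 supp (Lambda i) `<=`
                   @grid_incl m r @` (@MPstar m r @^-1` [set i])]) /\
          ((Num.min m%:R (c1 * Num.sqrt r%:R))%R%:E <=
             orth (Lambda true \- Lambda false)%R)%E].
Proof.
(* [1/100] serves both as the comparison constant of [near_envelope] and as the factor in the degree
   bound; [1/20] is the decay rate allowed by [200 n alpha <= 1]. *)
exists 100^-1, 20^-1; split; [lra|lra|] => m r m0 r0.
have [l1 [l2 [nl1 nl2 mom]]] := moment_matching_exists R r0.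
set alpha := 20^-1 / Num.sqrt r%:R in nl1 nl2 *.
have B0 : Bstar_shift r 100^-1 alpha 1 (point0 R) by apply: Bstar_shift_point0; lra.
have B1 := Bstar_shift1 r0 nl1.
have B2 := Bstar_shift1 r0 nl2.
have shift_mass l : near_envelope r alpha l -> \sum_(j < r.+1) shift1 l j = 1.
  move=> [_ _ ls]; have := shift1_moment r 0 l.
  under eq_bigr do rewrite expr0 mulr1.
  by under [RHS]eq_bigr do rewrite expr0 mulr1; rewrite ls.
have point_mass : \sum_(j < r.+1) point0 R j = 1.
  transitivity (\sum_(j < r.+1) point0 R j * j%:R ^+ 0); last exact: point0_moment.
  by apply: eq_bigr => j _; rewrite expr0 mulr1.
have shift_supp l t : near_envelope r alpha l -> shift1 l t != 0 -> (1 <= t <= r)%N.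
  move=> [_ l0 _]; rewrite /shift1; case: t => [|t]; rewrite ?eqxx //= subn1 /=.
  by apply: contraNT; rewrite -leqNgt => /l0 ->.
have tensor_conv (L : {ffun 'I_m -> nat} -> R) :
    tensor_power (Bstar_shift r 100^-1 alpha 1) m L ->
    conv (tensor_power (Bstar_shift r 100^-1 alpha 1) m) L.
  move=> TL; exists 1%N, (fun=> 1), (fun=> L); split => //.
    by rewrite big_ord1.
  by move=> x; rewrite big_ord1 mul1r.
pose L1 : {ffun 'I_m -> nat} -> R := product_law (shift1 l1).
pose L0 : {ffun 'I_m -> nat} -> R := odd_mixture (point0 R) (shift1 l2).
have s1 x i : L1 x != 0 -> (1 <= x i <= r)%N.
  by move=> /prodf_neq0 nz; apply: (shift_supp l1 _ nl1); exact: nz.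
(* Some component of the mixture is nonzero at [x]; its [f] has a true coordinate, where the factor
   [point0] forces [x i = 0]. *)
have s0 x : L0 x != 0 -> (exists i, x i = 0%N) /\ forall i, (x i <= r)%N.
  move=> nz; have [f] : exists f : {ffun 'I_m -> bool},
      odd_weight R f * \prod_i (if f i then point0 R else shift1 l2) (x i) != 0.
    apply/existsP; apply: contraNT nz; rewrite negb_exists => /forallP h.
    by rewrite /L0 /odd_mixture big1 // => f _; have := h f; rewrite negbK => /eqP.
  rewrite mulf_eq0 negb_or => /andP[/odd_weight_neq0[i fi] /prodf_neq0 pz].
  have z j : f j -> x j = 0%N.
    move=> fj; have := pz j isT; rewrite fj /point0.
    by case: (x j =P 0%N) => //; rewrite eqxx.
  split; first by exists i; exact: z.
  move=> j; case fj : (f j); first by rewrite z.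
  by have := pz j isT; rewrite fj => /(shift_supp l2 _ nl2)/andP[].
have L1_ge0 x : 0 <= L1 x.
  by apply: prodr_ge0 => i _; case: B1 => -[].
have L0_ge0 x : 0 <= L0 x.
  apply: sumr_ge0 => f _; rewrite mulr_ge0 ?odd_weight_ge0 // prodr_ge0 // => i _.
  by case: (f i); [case: B0 => -[]|case: B2 => -[]].
exists (fun b => if b then L1 else L0); split; first case => /=.
- split.
  + split => //; rewrite (esum_finite_image (@grid_incl_inj m r)) //.
      rewrite (sum_grid_prod r (fun=> shift1 l1)).
      by rewrite big1 // => i _; exact: shift_mass.
    by move=> x nz; apply: grid_inclP => i; case/andP: (s1 x i nz).
  + by apply: tensor_conv; exists (fun=> shift1 l1).
  + move=> x nz.
    have [t xt] : exists t : {ffun 'I_m -> 'I_r.+1}, x = grid_incl t.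
      by apply: grid_inclP => i; case/andP: (s1 x i nz).
    exists t => //=; apply/forallP => i.
    by have /andP[] := s1 x i nz; rewrite xt ffunE.
- split.
  + split => //; rewrite (esum_finite_image (@grid_incl_inj m r)) //.
      rewrite exchange_big /=.
      rewrite -[in RHS](odd_weight_sum1 R m0); congr (_%:E); apply: eq_bigr => f _.
      rewrite -mulr_sumr (sum_grid_prod r (fun i => if f i then point0 R else shift1 l2)).
      rewrite big1 ?mulr1 // => i _; case: (f i); [exact: point_mass|exact: shift_mass].
    by move=> x nz; apply: grid_inclP; case: (s0 x nz).
  + apply: (conv_finType (@odd_weight_ge0 R m) (odd_weight_sum1 R m0)) => [f|x]; last by [].
    by exists (fun i => if f i then point0 R else shift1 l2) => // i; case: (f i).
  + move=> x nz; have [[i xi] xr] := s0 x nz; have [t xt] := grid_inclP xr.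
    exists t => //=; apply/negbTE/forallPn; exists i.
    by move: xi; rewrite xt ffunE => ->.
(* It suffices that every polynomial of degree below the minimum pairs to 0. *)
apply: le_ereal_inf_tmp => _ [p /= pz <-]; rewrite lee_fin leNgt.
apply: contraNN pz; rewrite lt_min ltr_nat => /andP[dm dr]; apply/eqP.
apply: (@poly_pairing_grid _ _ r) => [x /=|k kd].
  have [z1|nz _] := eqVneq (L1 x) 0.
    by rewrite z1 sub0r oppr_eq0 => /s0[_ /grid_inclP].
  by apply: grid_inclP => i; case/andP: (s1 x i nz).
(* Each single exponent is at most the total degree, so moment matching applies in every
   coordinate. *)
have kr i : (k i)%:R < 100^-1 * Num.sqrt r%:R :> R.
  apply: le_lt_trans dr; rewrite ler_nat; apply: leq_trans kd.
  by rewrite (bigD1 i) //= leq_addr.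
apply: product_odd_mixture_orth.
- by move=> i; rewrite !shift1_moment point0_moment mom.
- rewrite shift1_moment point0_moment.
  case: nl2 => _ _ <-; by apply: eq_bigr => t _; rewrite expr0 mulr1.
- exact: leq_ltn_trans kd dm.
Qed.
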